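(* A subgroup $\Lambda$ of $\mathbb{Z}\times\mathbb{Z}$ is treealisable if and only if either $\Lambda$ is two-dimensional (generated by two linearly independent vectors) or $\Lambda=\{(0,0)\}$.
   Context: A binary tree is a finite rooted plane tree in which every internal vertex has exactly two ordered children (left and right); $\mathcal{T}_n$ is the set of binary trees with $n$ leaves, leaves numbered $1,\dots,n$ from left to right. The left depth $\mathrm{ld}_T(i)$ (right depth $\mathrm{rd}_T(i)$) of a leaf $i$ is the number of steps to a left (right) child on the path from the root to $i$. For $T,T'\in\mathcal{T}_n$, $\Lambda_{T,T'}$ is the subgroup of $\mathbb{Z}\times\mathbb{Z}$ generated by $\{(\mathrm{ld}_T(i)-\mathrm{ld}_{T'}(i),\mathrm{rd}_T(i)-\mathrm{rd}_{T'}(i)):i=1,\dots,n\}$. A subgroup $\Lambda$ is treealisable if $\Lambda=\Lambda_{T,T'}$ for some $n\in\mathbb{N}_+$ and $T,T'\in\mathcal{T}_n$. *)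

(* Defs.v *)
From mathcomp Require Import all_boot all_order all_algebra.
From mathcomp Require Import classical_sets.

Set Implicit Arguments.
Unset Strict Implicit.
Unset Printing Implicit Defensive.

Import GRing.Theory.
Local Open Scope classical_set_scope.
Local Open Scope ring_scope.

Inductive bintree : Type :=
| Leaf : bintree
| Node : bintree -> bintree -> bintree.

Inductive step : Type := ToLeft | ToRight.

Definition is_left (s : step) : bool := if s is ToLeft then true else false.
Definition is_right (s : step) : bool := ~~ is_left s.

(* The paths from the root to the leaves, the leaves being listed from left to
   right. *)
Fixpoint leaf_paths (T : bintree) : seq (seq step) :=
  match T with
  | Leaf => [:: [::]]
  | Node l r => map (cons ToLeft) (leaf_paths l) ++
                map (cons ToRight) (leaf_paths r)
  end.

Definition num_leaves (T : bintree) : nat := size (leaf_paths T).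

Definition trees_with_leaves (n : nat) : set bintree :=
  [set T | num_leaves T = n].

(* Leaves are numbered from 1; the value is meaningful only for
   1 <= i <= num_leaves T. *)
Definition leaf_path (T : bintree) (i : nat) : seq step :=
  nth [::] (leaf_paths T) i.-1.

Definition left_depth (T : bintree) (i : nat) : nat :=
  count is_left (leaf_path T i).
Definition right_depth (T : bintree) (i : nat) : nat :=
  count is_right (leaf_path T i).

Definition is_subgroup (V : zmodType) (H : set V) : Prop :=
  H 0 /\ forall x y : V, H x -> H y -> H (x - y).

Definition generated_subgroup (V : zmodType) (S : set V) : set V :=
  smallest (@is_subgroup V) S.

Definition depth_difference (T T' : bintree) (i : nat) : int * int :=
  ((left_depth T i)%:Z - (left_depth T' i)%:Z,
   (right_depth T i)%:Z - (right_depth T' i)%:Z).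

Definition Lambda (n : nat) (T T' : bintree) : set (int * int) :=
  generated_subgroup
    [set depth_difference T T' i | i in [set i | (1 <= i <= n)%N]].

Definition treealisable (L : set (int * int)) : Prop :=
  exists (n : nat) (T T' : bintree),
    [/\ (0 < n)%N, trees_with_leaves n T, trees_with_leaves n T' &
        L = Lambda n T T'].

Definition linearly_independent (u v : int * int) : Prop :=
  forall a b : int, u *~ a + v *~ b = 0 -> a = 0 /\ b = 0.

Definition two_dimensional (L : set (int * int)) : Prop :=
  exists u v : int * int,
    linearly_independent u v /\ L = generated_subgroup [set u; v].

(* Main.v *)
(* If the differences of T and T' all lie on a line a x + b y = 0, then the
   sequences of leaf weights a ld + b rd of T and T' agree, and such a sequence
   determines the tree; so a treealisable subgroup of rank at most one is zero.

   Conversely, let N >= 2. Hanging a leaf at each step, the two spines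
   L R^y L^(N-1) R L and R L^(x+1) end at points that differ by (N - x, y). If
   (N, 0), (0, N) and (-x, y) are regarded as 0, the words of leaf depths to the
   left and to the right of the two ends become equal after some of the hanging
   leaves are expanded into combs. This gives two trees whose differences
   generate exactly the lattice spanned by (N, 0), (0, N) and (-x, y). Joining
   two such pairs of trees under a common root adds the two lattices, and a
   two-dimensional lattice contains N Z^2 for N = 2 |det|, hence is the sum of
   two lattices of this form, one for each basis vector. *)
Require Import Defs.
From mathcomp Require Import all_boot all_order all_algebra.
From mathcomp Require Import boolp classical_sets.
From mathcomp Require Import zify ring.

Import GRing.Theory.
Local Open Scope classical_set_scope.
Local Open Scope ring_scope.

(** * Subgroups of abelian groups, of Z and of Z x Z *)

Lemma subgroupN (V : zmodType) (H : set V) x : is_subgroup H -> H x -> H (- x).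
Proof. by move=> [H0 HB] Hx; rewrite -sub0r; apply: HB. Qed.

Lemma subgroupD (V : zmodType) (H : set V) x y : is_subgroup H -> H x -> H y -> H (x + y).
Proof.
by move=> sH Hx Hy; rewrite -[y]opprK; apply: sH.2 => //; apply: subgroupN.
Qed.

Lemma subgroupMn (V : zmodType) (H : set V) x n : is_subgroup H -> H x -> H (x *+ n).
Proof.
move=> sH Hx; elim: n => [|n IHn]; first by rewrite mulr0n; case: sH.
by rewrite mulrS; apply: subgroupD.
Qed.

Lemma subgroupMz (V : zmodType) (H : set V) x (n : int) : is_subgroup H -> H x -> H (x *~ n).
Proof.
move=> sH Hx; case: n => n; first exact: subgroupMn.
by rewrite NegzE mulrNz; apply: subgroupN => //; apply: subgroupMn.
Qed.

Lemma generated_subgroupP (V : zmodType) (S : set V) : is_subgroup (generated_subgroup S).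
Proof.
split=> [A [[]]//|x y Sx Sy A AS].
by apply: AS.1.2; [apply: Sx|apply: Sy].
Qed.

Lemma sub_generated_subgroup (V : zmodType) (S : set V) : S `<=` generated_subgroup S.
Proof. by move=> x Sx A [_]; apply. Qed.

Lemma generated_subgroup_sub (V : zmodType) (S H : set V) :
  is_subgroup H -> S `<=` H -> generated_subgroup S `<=` H.
Proof. by move=> sH SH x; apply. Qed.

(** Euclidean division by the least positive element of [H] leaves a remainder in [H], hence zero;
    the zero subgroup takes [d = 0]. *)
Lemma int_subgroup_principal (H : set int) : is_subgroup H ->
  exists d : int, H d /\ forall x, H x -> exists q, x = q * d.
Proof.
move=> sH; have [[x [Hx x0]]|H0] := pselect (exists x, H x /\ x != 0); last first.
  exists 0; split=> [|x Hx]; first exact: sH.1.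
  exists 0; apply/eqP; rewrite mulr0; apply/negPn/negP => x0; apply: H0.
  by exists x.
have ex : exists n : nat, `[< H n.+1%:Z >].
  exists `|x|%N.-1; apply/asboolP; rewrite prednK ?absz_gt0//.
  by case: (intP x) Hx => [|n|n] Hx; rewrite ?abszN //; rewrite -[X in H X]opprK;
    apply: subgroupN.
case: (ex_minnP ex) => n /asboolP Hn min_n.
exists n.+1%:Z; split=> // y Hy; exists (y %/ n.+1)%Z.
rewrite {1}(divz_eq y n.+1); case: (intP (y %% n.+1)%Z) (modz_ge0 y (isT : n.+1%:Z != 0))
  (ltz_pmod y (isT : 0 < n.+1%:Z)) (divz_eq y n.+1) => [|m|m]//; first by rewrite addr0.
move=> _ ltmn Ey; exfalso.
suff /asboolP /min_n : H m.+1%:Z by lia.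
have -> : m.+1%:Z = y - n.+1%:Z *~ (y %/ n.+1)%Z by rewrite {1}Ey mulrzz; lia.
by apply: sH.2 => //; apply: subgroupMz.
Qed.

Lemma pairMz (u : int * int) (n : int) : u *~ n = (u.1 * n, u.2 * n).
Proof.
suff E (k : nat) : u *+ k = (u.1 * k%:Z, u.2 * k%:Z).
  case: n => k; first by rewrite -pmulrn E.
  by rewrite NegzE mulrNz -pmulrn E; congr (_, _) => /=; rewrite mulrN.
elim: k => [|k IHk]; first by rewrite mulr0n !mulr0.
by rewrite mulrS IHk; congr (_, _) => /=; lia.
Qed.

(** Echelon form: [e] generates the first projection and [d] the part on the axis x = 0, so [H] is
    spanned by [(e, f)] and [(0, d)]. These are independent unless [e] or [d] vanishes. *)
Lemma subgroup_two_dimensional_or_line (H : set (int * int)) : is_subgroup H ->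
  two_dimensional H \/
  exists a b : int, (a != 0) || (b != 0) /\
    forall u, H u -> a * u.1 + b * u.2 = 0.
Proof.
move=> sH.
have s1 : is_subgroup [set x | exists y, H (x, y)].
  split=> [|x x' [y Hy] [y' Hy']]; first by exists 0; exact: sH.1.
  by exists (y - y'); apply: (sH.2 _ _ Hy Hy').
have s2 : is_subgroup [set y | H (0, y)].
  split=> [|y y' Hy Hy'/=]; first exact: sH.1.
  by have := sH.2 _ _ Hy Hy'.
have [e [[f Hef] He]] := int_subgroup_principal _ s1.
have [d [Hd Hd']] := int_subgroup_principal _ s2.
have span u : H u -> exists p q, u = (e, f) *~ p + (0, d) *~ q.
  case: u => x y Hxy; have [|p xE] := He x; first by exists y.
  have [|q yE] := Hd' (y - f * p).
    have := sH.2 _ _ Hxy (subgroupMz _ _ _ p sH Hef).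
    by rewrite pairMz /= xE mulrC /= => h; move: h; congr H; congr (_, _) => /=; lia.
  by exists p, q; rewrite !pairMz; congr (_, _) => /=; lia.
have [e0|e0] := eqVneq e 0.
  right; exists 1, 0; split=> // u /span[p [q ->]].
  by rewrite !pairMz /= e0; lia.
have [d0|d0] := eqVneq d 0.
  right; exists f, (- e); split=> [|u /span[p [q ->]]]; first by rewrite oppr_eq0 e0 orbT.
  by rewrite !pairMz /= d0; lia.
left; exists (e, f), (0, d); split.
  move=> a b; rewrite !pairMz => -[/=].
  rewrite mul0r addr0 => /eqP; rewrite mulf_eq0 (negPf e0)/= => /eqP ->.
  by rewrite mulr0 add0r => /eqP; rewrite mulf_eq0 (negPf d0) => /eqP.
apply/seteqP; split=> [u /span[p [q ->]]|].
  have sG := @generated_subgroupP _ [set (e, f); (0, d)].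
  apply: (subgroupD _ _ _ _ sG); apply: (subgroupMz _ _ _ _ sG);
    apply: sub_generated_subgroup; by [left|right].
by apply: generated_subgroup_sub => // u [->|->].
Qed.

(** * Words of leaf depths and their differences *)

(** [(i, j)] is the position of the root of [T] inside a larger tree. *)
Fixpoint depths_at (i j : nat) (T : bintree) : seq (nat * nat) :=
  match T with
  | Leaf => [:: (i, j)]
  | Node l r => depths_at i.+1 j l ++ depths_at i j.+1 r
  end.

Lemma depths_atE i j T : depths_at i j T =
  [seq (i + count Defs.is_left p, j + count Defs.is_right p)%N | p <- leaf_paths T].
Proof.
elim: T i j => [|l IHl r IHr] i j /=; first by rewrite !addn0.
rewrite map_cat -!map_comp IHl IHr; congr (_ ++ _); apply: eq_map => p /=;
  by rewrite add0n ?add1n ?addSnnS.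
Qed.

Lemma size_depths_at i j T : size (depths_at i j T) = num_leaves T.
Proof. by rewrite depths_atE size_map. Qed.

Lemma num_leaves_node l r :
  num_leaves (Node l r) = (num_leaves l + num_leaves r)%N.
Proof. by rewrite /num_leaves/= size_cat !size_map. Qed.

Lemma num_leaves_gt0 T : (0 < num_leaves T)%N.
Proof. by elim: T => // l IHl r IHr; rewrite num_leaves_node addn_gt0 IHl. Qed.

Definition pair_diff (pq : (nat * nat) * (nat * nat)) : int * int :=
  (pq.1.1%:Z - pq.2.1%:Z, pq.1.2%:Z - pq.2.2%:Z).

Definition differences (s t : seq (nat * nat)) : seq (int * int) :=
  map pair_diff (zip s t).

Lemma differences_cat s1 s2 t1 t2 : size s1 = size t1 ->
  differences (s1 ++ s2) (t1 ++ t2) = differences s1 t1 ++ differences s2 t2.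
Proof. by move=> st; rewrite /differences zip_cat // map_cat. Qed.

Lemma differences_map (I : Type) (s : seq I) (f g : I -> nat * nat) c :
  (forall k, pair_diff (f k, g k) = c) ->
  differences (map f s) (map g s) = nseq (size s) c.
Proof. by move=> fg; elim: s => //= k s <-; rewrite /differences /= fg. Qed.

(** A common displacement of both roots cancels, so joining two pairs of trees under a common root
    merely concatenates their differences. *)
Lemma differences_shift i j i' j' T T' : num_leaves T = num_leaves T' ->
  differences (depths_at (i + i') (j + j') T) (depths_at (i + i') (j + j') T') =
  differences (depths_at i j T) (depths_at i j T').
Proof.
rewrite !depths_atE /num_leaves; move: (leaf_paths T) (leaf_paths T').
elim=> [|p s IHs] [|q t] //= [/IHs st].
rewrite /differences /= -!/(differences _ _) st; congr (_ :: _).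
by congr (_, _) => /=; lia.
Qed.

Lemma Lambda_differences T T' : num_leaves T = num_leaves T' ->
  Lambda (num_leaves T) T T' =
  generated_subgroup
    [set d | d \in differences (depths_at 0 0 T) (depths_at 0 0 T')].
Proof.
move=> TT'; congr generated_subgroup.
(* Leaves are counted from 1 and list entries from 0; the bound keeps each [nth] away from its
   default. *)
have dE i : (i < num_leaves T)%N -> depth_difference T T' i.+1 =
    nth 0 (differences (depths_at 0 0 T) (depths_at 0 0 T')) i.
  move=> iT; rewrite (nth_map ((0, 0), (0, 0))%N); last first.
    by rewrite size_zip !size_depths_at -TT' minnn.
  rewrite nth_zip ?size_depths_at// !depths_atE.
  by rewrite !(nth_map [::]) -?/(num_leaves _) -?TT'.
have sE : size (differences (depths_at 0 0 T) (depths_at 0 0 T')) = num_leaves T.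
  by rewrite size_map size_zip !size_depths_at -TT' minnn.
apply/seteqP; split=> [_ [[//|i] /= iT <-]|d /= /(nthP 0)[i]].
  by rewrite dE // mem_nth // sE.
by rewrite sE => iT <-; exists i.+1 => //=; rewrite dE.
Qed.

(** * Recovering a tree from its leaf weights *)

Fixpoint weights (a b w : int) (T : bintree) : seq int :=
  match T with
  | Leaf => [:: w]
  | Node l r => weights a b (w + a) l ++ weights a b (w + b) r
  end.

Lemma weights_depths_at a b i j T :
  [seq a * p.1%:Z + b * p.2%:Z | p <- depths_at i j T] =
  weights a b (a * i%:Z + b * j%:Z) T.
Proof.
elim: T i j => [|l IHl r IHr] i j //=; rewrite map_cat IHl IHr.
by congr (weights _ _ _ _ ++ weights _ _ _ _); lia.
Qed.

(** [k] is the length of the left spine, which ends at the first leaf. *)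
Lemma weights_head a b w T : exists k s,
  weights a b w T = w + a * k%:Z :: s /\ (k = 0%N -> T = Leaf).
Proof.
elim: T w => [|l IHl r IHr] w; first by exists 0%N, [::]; rewrite mulr0 addr0.
have [k [s [wl _]]] := IHl (w + a).
exists k.+1, (s ++ weights a b (w + b) r); split=> //=.
by rewrite wl cat_cons; congr (_ :: _); lia.
Qed.

(* For [a != 0] the first weight of a subtree, compared with the weight of its
   root, tells whether the subtree is a leaf; so the word of weights can be
   parsed from left to right. *)
Lemma weights_prefix_inj a b w T T' s s' : a != 0 ->
  weights a b w T ++ s = weights a b w T' ++ s' -> T = T'.
Proof.
move=> a0.
have leaf_case S w' t t' : w' :: t = weights a b w' S ++ t' -> Leaf = S.
  have [k [u [-> kS]]] := weights_head a b w' S; case=> w'E _.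
  have /eqP : a * k%:Z = 0 by lia.
  by rewrite mulf_eq0 (negPf a0) /= => /eqP[/kS].
elim: T w T' s s' => [|l IHl r IHr] w T' s s'; first exact: leaf_case.
case: T' => [/esym/leaf_case//|l' r'] /=; rewrite -!catA => E.
have El := IHl _ _ _ _ E; move: E; rewrite El => /eqP.
by rewrite eqseq_cat // eqxx => /eqP/IHr ->.
Qed.

Fixpoint mirror (T : bintree) : bintree :=
  if T is Node l r then Node (mirror r) (mirror l) else Leaf.

Lemma mirrorK : involutive mirror.
Proof. by elim=> //= l -> r ->. Qed.

Lemma weights_mirror a b w T : weights a b w (mirror T) = rev (weights b a w T).
Proof. by elim: T w => //= l IHl r IHr w; rewrite rev_cat IHl IHr. Qed.

(** Mirroring exchanges [a] and [b] and reverses the words, which reduces [b != 0] to the case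
    [a != 0]. *)
Lemma weights_inj a b w T T' : (a != 0) || (b != 0) ->
  weights a b w T = weights a b w T' -> T = T'.
Proof.
case/orP=> [a0|b0] TT'.
  by apply: (weights_prefix_inj a b w T T' [::] [::]); rewrite ?cats0.
apply: (can_inj mirrorK).
by apply: (weights_prefix_inj b a w _ _ [::] [::]); rewrite ?cats0 ?weights_mirror ?TT'.
Qed.

Lemma differences_on_line a b s t : size s = size t ->
  (forall d, d \in differences s t -> a * d.1 + b * d.2 = 0) ->
  [seq a * p.1%:Z + b * p.2%:Z | p <- s] = [seq a * p.1%:Z + b * p.2%:Z | p <- t].
Proof.
elim: s t => [|p s IHs] [|q t] //= [st] line; congr (_ :: _).
  by have := line _ (mem_head _ _); rewrite /=; lia.
by apply: IHs => // d dst; apply: line; rewrite inE dst orbT.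
Qed.

Lemma differences_diag s d : d \in differences s s -> d = 0.
Proof.
elim: s => //= p s IHs; rewrite inE => /orP[/eqP ->|//].
by rewrite /pair_diff !subrr.
Qed.

Lemma treealisable_rank L : treealisable L ->
  two_dimensional L \/ L = [set (0, 0)].
Proof.
move=> [_ [T [T' [_ <- /esym TT' LE]]]].
rewrite Lambda_differences// in LE.
have sL : is_subgroup L by rewrite LE; apply: generated_subgroupP.
have [|[a [b [ab line]]]] := subgroup_two_dimensional_or_line L sL; first by left.
right; suff TT'E : T = T'.
  apply/seteqP; split=> [|_ ->]; last exact: sL.1.
  rewrite LE; apply: generated_subgroup_sub.
    by split=> [//|_ _ -> ->]; rewrite /= subrr.
  by move=> d /=; rewrite TT'E => /differences_diag.
(* The root weight 0 is left unsimplified to match [weights_depths_at]. *)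
apply: (weights_inj a b (a * 0%N%:Z + b * 0%N%:Z)) => //.
rewrite -!weights_depths_at; apply: differences_on_line.
  by rewrite !size_depths_at.
by move=> d dTT'; apply: line; rewrite LE; apply: sub_generated_subgroup.
Qed.

(** * Comb trees and the lattices they realise *)

Definition right_comb n t := iter n (Node Leaf) t.
Definition left_comb n t := iter n (fun s => Node s Leaf) t.

Lemma depths_right_comb i j n t : depths_at i j (right_comb n t) =
  [seq (i.+1, j + k)%N | k <- iota 0 n] ++ depths_at i (j + n) t.
Proof.
elim: n j => [|n IHn] j /=; first by rewrite addn0.
rewrite IHn addn0 addSnnS (iotaDl 1 0) -map_comp; congr (_ :: _ ++ _).
by apply: eq_map => k /=; rewrite addSnnS.
Qed.

(** The hanging leaves come after [t] and are met from the bottom of the spine upwards, hence the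
    reversed index list. *)
Lemma depths_left_comb i j n t : depths_at i j (left_comb n t) =
  depths_at (i + n) j t ++ [seq (i + k, j.+1)%N | k <- rev (iota 0 n)].
Proof.
elim: n i => [|n IHn] i /=; first by rewrite addn0 cats0.
rewrite IHn addSnnS -catA (iotaDl 1 0) rev_cons map_rcons -cats1 addn0; congr (_ ++ (_ ++ _)).
by rewrite -map_rev -map_comp; apply: eq_map => k /=; rewrite addSnnS.
Qed.

(* The spines of these two trees are L R^y L^(m+1) R L and R L^(x+1). *)
Definition comb_tree m x y :=
  Node (right_comb y (left_comb m.+1
          (Node Leaf (Node Leaf (right_comb m.+1 Leaf)))))
       (left_comb x Leaf).
Definition comb_tree' m x y :=
  Node (right_comb y Leaf)
       (left_comb x (Node Leaf (right_comb m (Node (left_comb m.+2 Leaf) Leaf)))).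

Lemma differences_comb m x y :
  differences (depths_at 0 0 (comb_tree m x y)) (depths_at 0 0 (comb_tree' m x y))
  = nseq y 0 ++ (m.+2%:Z, 0) :: (m.+2%:Z - x%:Z, y%:Z) ::
    nseq m (m.+2%:Z - x%:Z, y%:Z) ++ [:: (- x%:Z, y%:Z), (- x%:Z, y%:Z) &
    nseq m.+1 (- x%:Z, y%:Z - m.+2%:Z) ++ (0, - m.+2%:Z) :: nseq x 0].
Proof.
have iotaS n : iota 0 n.+1 = iota 0 n ++ [:: n] by rewrite -addn1 iotaD add0n.
have nodeE i j l r : depths_at i j (Node l r) =
  depths_at i.+1 j l ++ depths_at i j.+1 r by [].
have leafE i j : depths_at i j Leaf = [:: (i, j)] by [].
rewrite /comb_tree /comb_tree'.
rewrite !(depths_right_comb, depths_left_comb, nodeE, leafE).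
(* Two leaves are split off so that the blocks align: the first leaf hanging from the long left comb
   of [comb_tree'], and the last one hanging from the right comb of length [m.+1] in [comb_tree].
   Folding [J] protects the remaining left-comb leaves from the second splitting. *)
rewrite [iota 0 m.+2]iotaS rev_cat map_cat; set J := rev (iota 0 m.+1).
rewrite (iotaS m) map_cat -!catA !differences_cat ?size_map ?size_rev //.
rewrite (differences_map _ (iota 0 y) _ _ 0); last first.
  by move=> k; rewrite /pair_diff !subrr.
rewrite (differences_map _ (iota 0 m) _ _ (m.+2%:Z - x%:Z, y%:Z)); last first.
  by move=> k; congr (_, _) => /=; lia.
rewrite (differences_map _ J _ _ (- x%:Z, y%:Z - m.+2%:Z)); last first.
  by move=> k; congr (_, _) => /=; lia.
rewrite (differences_map _ (rev (iota 0 x)) _ _ 0); last first.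
  by move=> k; rewrite /pair_diff !subrr.
rewrite /J !size_rev !size_iota /differences /= /pair_diff /=.
by do ![congr (_ ++ _) | congr (_ :: _) | congr (_, _)]; lia.
Qed.

Lemma num_leaves_right_comb n t : num_leaves (right_comb n t) = (n + num_leaves t)%N.
Proof. by elim: n => //= n IHn; rewrite num_leaves_node IHn. Qed.

Lemma num_leaves_left_comb n t : num_leaves (left_comb n t) = (num_leaves t + n)%N.
Proof.
elim: n => [|n IHn]; first by rewrite addn0.
by rewrite [LHS]num_leaves_node IHn -addnA addn1.
Qed.

Lemma num_leaves_comb_tree m x y :
  num_leaves (comb_tree m x y) = num_leaves (comb_tree' m x y).
Proof.
have leafE : num_leaves Leaf = 1%N by [].
rewrite /comb_tree /comb_tree'.
by rewrite !(num_leaves_right_comb, num_leaves_left_comb, num_leaves_node, leafE); lia.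
Qed.

(** Quantifying over [H] expresses that the differences and the three vectors generate the same
    subgroup. *)
Lemma trees_with_differences m (u : int * int) : exists T T',
  num_leaves T = num_leaves T' /\ forall H, is_subgroup H ->
    (forall d, d \in differences (depths_at 0 0 T) (depths_at 0 0 T') -> H d) <->
    [/\ H (m.+2%:Z, 0), H (0, m.+2%:Z) & H u].
Proof.
(* These multiples of [m.+2] are large enough to make [p - u.1] and [q + u.2] nonnegative; then (-x,
   y) agrees with [u] modulo [m.+2]. *)
pose p := (`|u.1|%N * m.+2)%N; pose q := (`|u.2|%N * m.+2)%N.
have [x xE] : exists x : nat, x%:Z = p%:Z - u.1.
  by exists (absz (p%:Z - u.1)); rewrite gez0_abs // /p; nia.
have [y yE] : exists y : nat, y%:Z = q%:Z + u.2.
  by exists (absz (q%:Z + u.2)); rewrite gez0_abs // /q; nia.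
exists (comb_tree m x y), (comb_tree' m x y); split; first exact: num_leaves_comb_tree.
move=> H sH; rewrite differences_comb; split=> [Hd|[H1 H2 Hu]].
  have H1 : H (m.+2%:Z, 0) by apply: Hd; rewrite !(mem_cat, inE) eqxx !orbT.
  have H2 : H (0, m.+2%:Z).
    rewrite -[X in H X]opprK; apply: (subgroupN _ _ _ sH).
    have -> : - (0, m.+2%:Z) = (0, - m.+2%:Z) :> (int * int)%type by congr (_, _).
    by apply: Hd; rewrite !(mem_cat, inE) eqxx !orbT.
  have H3 : H (- x%:Z, y%:Z) by apply: Hd; rewrite !(mem_cat, inE) eqxx !orbT.
  split=> //.
  have -> : u = (- x%:Z, y%:Z) + ((m.+2%:Z, 0) *+ `|u.1|%N - (0, m.+2%:Z) *+ `|u.2|%N).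
    rewrite !pmulrn !pairMz; case: u {H1 H2 H3 Hd} @p @q xE yE => u1 u2 p q xE yE.
    by congr (_, _) => /=; rewrite /p /q /= in xE yE *; lia.
  by apply: (subgroupD _ _ _ _ sH) => //; apply: sH.2; apply: (subgroupMn _ _ _ _ sH).
have H3 : H (- x%:Z, y%:Z).
  have -> : (- x%:Z, y%:Z) = u - ((m.+2%:Z, 0) *+ `|u.1|%N - (0, m.+2%:Z) *+ `|u.2|%N).
    rewrite !pmulrn !pairMz; case: u {H1 H2 Hu} @p @q xE yE => u1 u2 p q xE yE.
    by congr (_, _) => /=; rewrite /p /q /= in xE yE *; lia.
  by apply: sH.2 => //; apply: sH.2; apply: (subgroupMn _ _ _ _ sH).
have H4 : H (m.+2%:Z - x%:Z, y%:Z).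
  have -> : (m.+2%:Z - x%:Z, y%:Z) = (m.+2%:Z, 0) + (- x%:Z, y%:Z).
    by congr (_, _) => /=; lia.
  exact: subgroupD.
have H5 : H (- x%:Z, y%:Z - m.+2%:Z).
  have -> : (- x%:Z, y%:Z - m.+2%:Z) = (- x%:Z, y%:Z) - (0, m.+2%:Z).
    by congr (_, _) => /=; lia.
  exact: sH.2.
have H6 : H (0, - m.+2%:Z).
  have -> : (0, - m.+2%:Z) = - (0, m.+2%:Z) :> (int * int)%type by congr (_, _).
  exact: subgroupN.
have H0 : H 0 by exact: sH.1.
move=> d; rewrite !(mem_cat, inE, mem_nseq).
by do ?case/orP; by [move=> /eqP -> | case/andP=> _ /eqP ->].
Qed.

(** * Realising two-dimensional and trivial subgroups *)

Lemma two_dimensional_treealisable L : two_dimensional L -> treealisable L.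
Proof.
move=> [u [v [indep LE]]].
have sL : is_subgroup L by rewrite LE; apply: generated_subgroupP.
have Lu : L u by rewrite LE; apply: sub_generated_subgroup; left.
have Lv : L v by rewrite LE; apply: sub_generated_subgroup; right.
pose D := u.1 * v.2 - u.2 * v.1.
have D0 : D != 0.
  (* If [D = 0], two relations between [u] and [v] force all four coordinates to vanish, and then 1
     u + 0 v = 0 contradicts independence. *)
  apply/eqP => D0.
  have [v20 u20] : v.2 = 0 /\ - u.2 = 0.
    by apply: indep; rewrite !pairMz; congr (_, _) => /=; rewrite /D in D0; lia.
  have [v10 u10] : v.1 = 0 /\ - u.1 = 0.
    by apply: indep; rewrite !pairMz; congr (_, _) => /=; rewrite /D in D0; lia.
  have [] : (1 : int) = 0 /\ (0 : int) = 0 => //.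
  by apply: indep; rewrite !pairMz; congr (_, _) => /=; lia.
(* Thus [m.+2] is 2 |D|; the truncated subtraction is exact because [D != 0]. *)
pose m := (`|D| * 2 - 2)%N.
have [c cE] : exists c, m.+2%:Z = c * D.
  by exists (sgz D * 2); rewrite mulrAC -abszEsg /m; lia.
(* Cramer's rule gives [D] times each unit vector as a combination of [u] and [v]; the factor [c]
   turns [D] into [m.+2]. *)
have L1 : L (m.+2%:Z, 0).
  have -> : (m.+2%:Z, 0) = u *~ (c * v.2) - v *~ (c * u.2).
    by rewrite !pairMz cE; congr (_, _) => /=; rewrite /D; ring.
  by apply: sL.2; apply: (subgroupMz _ _ _ _ sL).
have L2 : L (0, m.+2%:Z).
  have -> : (0, m.+2%:Z) = v *~ (c * u.1) - u *~ (c * v.1).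
    by rewrite !pairMz cE; congr (_, _) => /=; rewrite /D; ring.
  by apply: sL.2; apply: (subgroupMz _ _ _ _ sL).
have [T1 [T1' [n1 dT1]]] := trees_with_differences m u.
have [T2 [T2' [n2 dT2]]] := trees_with_differences m v.
have nE : num_leaves (Node T1 T2) = num_leaves (Node T1' T2').
  by rewrite !num_leaves_node n1 n2.
exists (num_leaves (Node T1 T2)), (Node T1 T2), (Node T1' T2').
split=> //; first exact: num_leaves_gt0.
rewrite Lambda_differences //= differences_cat ?size_depths_at //.
rewrite (differences_shift 0 0 1 0) // (differences_shift 0 0 0 1) //.
set S := [set d | _]; have sS := @generated_subgroupP _ S.
(* The direct implications of [dT1] and [dT2] put [u] and [v] in the subgroup generated by [S]; the
   converse ones, applied to [L], put [S] in [L]. *)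
apply/seteqP; split.
  rewrite LE; apply: generated_subgroup_sub => // _ [->|->].
    have /(dT1 _ sS)[]// : forall d, d \in differences (depths_at 0 0 T1) (depths_at 0 0 T1')
      -> generated_subgroup S d.
    by move=> d dT; apply: sub_generated_subgroup; rewrite /S /= mem_cat dT.
  have /(dT2 _ sS)[]// : forall d, d \in differences (depths_at 0 0 T2) (depths_at 0 0 T2')
    -> generated_subgroup S d.
  by move=> d dT; apply: sub_generated_subgroup; rewrite /S /= mem_cat dT orbT.
apply: generated_subgroup_sub => // d; rewrite /S /= mem_cat => /orP[].
  by apply: (dT1 L sL).2.
by apply: (dT2 L sL).2.
Qed.

Lemma trivial_treealisable : treealisable [set (0, 0)].
Proof.
exists 1%N, Leaf, Leaf; split=> //.
rewrite (Lambda_differences Leaf Leaf) //; set S := [set d | _].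
apply/seteqP; split=> [_ ->|]; first exact: (generated_subgroupP _ S).1.
apply: generated_subgroup_sub; first by split=> [//|_ _ -> ->]; rewrite /= subrr.
by move=> d /differences_diag.
Qed.

Theorem theorem5p16 (L : set (int * int)) (hL : is_subgroup L) :
  treealisable L <-> two_dimensional L \/ L = [set (0, 0)].
Proof.
split=> [|[|->]]; first exact: treealisable_rank.
  exact: two_dimensional_treealisable.
exact: trivial_treealisable.
Qed.
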